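(* For each $k \in \mathbb{N}$ there exists an absolute constant $c_k > 0$ (depending only on $k$) such that the following holds: for any $n \in \mathbb{N}$, if $A \subseteq \mathbb{Z}_n$ is a basis for $\mathbb{Z}_n$ for which $\rho_n(A) \geq n/k$, then there is some integer $l \in [1,k]$ such that $|\rho_n(A) - n/l| < c_k$.
   Context: $\mathbb{N}$ denotes the positive integers. $\mathbb{Z}_n$ denotes the cyclic group of integers modulo $n$, written additively. For a subset $A \subseteq \mathbb{Z}_n$ and a positive integer $h$, the $h$-fold sumset is $hA = \{a_1 + \cdots + a_h : a_i \in A\}$ (the $a_i$ are not necessarily distinct). The set $A$ is called a basis for $\mathbb{Z}_n$ if $hA = \mathbb{Z}_n$ for some $h \in \mathbb{N}$. The order of a basis $A$ is $\rho_n(A) := \min\{h \in \mathbb{N} : hA = \mathbb{Z}_n\}$. If $A$ is not a basis, one sets $\rho_n(A) := \infty$. *)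

(* Defs.v *)
From HB Require Import structures.
From mathcomp Require Import all_boot all_order all_algebra.
From mathcomp Require Import boolp reals constructive_ereal.

Set Implicit Arguments.
Unset Strict Implicit.
Unset Printing Implicit Defensive.

Import Order.TTheory GRing.Theory Num.Theory.
Local Open Scope ring_scope.

(* The cyclic group of integers modulo n >= 1, written additively. The type
   'I_n.+1 carries the additive group structure of integers modulo n.+1; the
   notation 'Z_n is avoided because 'Z_1 has two elements. *)
Notation Zmod n := 'I_(n.-1).+1 (only parsing).

Definition sumset (G : finZmodType) (h : nat) (A : {set G}) : {set G} :=
  [set \sum_(i < h) a i | a : {ffun 'I_h -> G} & [forall i, a i \in A]].

Definition is_basis (G : finZmodType) (A : {set G}) : Prop :=
  exists h : nat, (0 < h)%N && (sumset h A == [set: G]).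

(* ex_minn returns the least witness of is_basis A. *)
Definition rho (R : realType) (G : finZmodType) (A : {set G}) : \bar R :=
  if pselect (is_basis A) is left basisA then (ex_minn basisA)%:R%:E
  else +oo%E.

(* Main.v *)
Require Import Defs.
From HB Require Import structures.
From mathcomp Require Import all_boot all_order all_algebra.
From mathcomp Require Import boolp reals constructive_ereal.
From mathcomp Require Import zify ring.

Set Implicit Arguments.
Unset Strict Implicit.
Unset Printing Implicit Defensive.

Import Order.TTheory GRing.Theory Num.Theory.
Local Open Scope ring_scope.

(** Everything works in an arbitrary finite abelian group G of size n, and the
    bounds called constants below depend on k only. Translating A changes no
    order, so 0 may be assumed to lie in A; then the sumsets hA increase, and
    if h is the order of A some g is a sum of h elements of A but of no fewer.

    One summand dominates. Among the ways of writing g with h summands, choose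
    the multiplicities x so that the sum of the squares of the x b is largest.
    If two distinct sub-multisets of x had the same sum, they would have the
    same size, and exchanging one for the other, in either direction, would
    give two representations of g whose squares add up to more than twice those
    of x ([subrepresentation_inj]). So the sub-multisets have distinct sums,
    the product of the x b + 1 is at most n <= k h = k (sum of the x b), and
    this forces all but a constant number of the h summands to be one element a
    ([dominant_coord]). Hence, for X = h - O(1), no multiple j a with j <= X is
    a sum of fewer than j elements of A ([geodesic_straight]).

    Everything is commensurable with a. As X is a positive proportion of n, the
    pigeonhole principle gives for each b in A a relation s b = r a with s
    bounded and |r| < X / 2; were r large, going around the group by means of b
    would reach X a too quickly, so r is bounded too ([straight_relation]).
    With a common multiple S of the s one gets S b = (R b) a for all b in A,
    with bounded heights R b, and then A itself is bounded
    ([card_commensurable]). After a second translation the heights run from 0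
    to some D > 0.

    Counting by height. An integer combination of elements of A has a height,
    extended linearly from R, and the heights that represent 0 form a group qZ.
    An element has a height in every window of length q, and since
    S D b = S (R b) t for t of height D, every element with a height between
    O(D) and h D - O(D) lies in hA ([height_represents]); conversely the
    heights of elements of hA lie in [0, h D]. So the order of A is
    q / D + O(1). Finally n t = 0 has height n D, so n D = l q for an integer l
    ([period_exists]), and the order is n / l + O(1). That l <= k follows from
    the lower bound n / k on the order, once n is large. *)

(** * Sumsets through multiplicities *)

Definition represents (G : finZmodType) (A : {set G}) (h : nat) (g : G) : Prop :=
  exists x : G -> nat,
    (\sum_(b in A) x b = h)%N /\ \sum_(b in A) b *+ x b = g.

(** Multiplicities are easier to exchange and to scale than ordered families of
    summands, which is why the argument runs on [represents]. *)
Lemma sumsetP (G : finZmodType) (A : {set G}) h g :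
  (g \in sumset h A) <-> represents A h g.
Proof.
split=> [/imsetP[f] | [x [xh xg]]].
  rewrite inE => /forallP fA ->.
  exists (fun b => \sum_(i < h | f i == b) 1)%N; split.
    rewrite -[RHS](card_ord h) -sum1_card.
    by rewrite [RHS](partition_big f (mem A)) => [|i _]; last exact: fA.
  rewrite [RHS](partition_big f (mem A)) => [|i _]; last exact: fA.
  apply: eq_bigr => b _; rewrite sum1_card.
  rewrite (eq_bigr (fun=> b)) => [|i /eqP //].
  by rewrite sumr_const.
pose s := flatten [seq nseq (x b) b | b <- enum A].
have size_s : size s = h.
  rewrite size_flatten /shape -map_comp sumnE big_map -xh big_enum.
  by apply: eq_bigr => b _; rewrite /= size_nseq.
have sumE : \sum_(b <- s) b = g.
  rewrite big_flatten big_map -xg big_enum; apply: eq_bigr => b _.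
  by rewrite big_nseq -Monoid.iteropE.
apply/imsetP; exists [ffun i : 'I_h => s`_i]; last first.
  rewrite -sumE (big_nth 0) size_s big_mkord.
  by apply: eq_bigr => i _; rewrite ffunE.
rewrite inE; apply/forallP => i; rewrite ffunE.
have : s`_i \in s by rewrite mem_nth ?size_s.
case/flattenP => t /mapP[b]; rewrite mem_enum => bA ->.
by rewrite mem_nseq => /andP[_ /eqP ->].
Qed.

Lemma representsD (G : finZmodType) (A : {set G}) h1 h2 g1 g2 :
  represents A h1 g1 -> represents A h2 g2 -> represents A (h1 + h2) (g1 + g2).
Proof.
move=> [x [<- <-]] [y [<- <-]]; exists (fun b => x b + y b)%N.
by split; rewrite -big_split //=; apply: eq_bigr => b _; rewrite mulrnDr.
Qed.

Lemma represents_mulrn (G : finZmodType) (A : {set G}) b j :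
  b \in A -> represents A j (b *+ j).
Proof.
move=> bA; exists (fun c => (c == b) * j)%N; split.
  rewrite (bigD1 b) //= eqxx mul1n big1 ?addn0 // => c /andP[_ /negbTE ->].
  by rewrite mul0n.
rewrite (bigD1 b) //= eqxx mul1n big1 ?addr0 // => c /andP[_ /negbTE ->].
by rewrite mul0n mulr0n.
Qed.

Lemma represents_leq (G : finZmodType) (A : {set G}) h h' g :
  0 \in A -> (h <= h')%N -> represents A h g -> represents A h' g.
Proof.
move=> A0 /subnKC <- hg; rewrite -[g]addr0 -(mul0rn G (h' - h)).
exact: representsD hg (represents_mulrn _ A0).
Qed.

Definition translate (G : finZmodType) (A : {set G}) (c : G) : {set G} :=
  [set b - c | b in A].

Lemma translateE (G : finZmodType) (A : {set G}) (c b : G) :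
  (b \in translate A c) = (b + c \in A).
Proof.
apply/imsetP/idP => [[d dA ->]|bcA]; first by rewrite subrK.
by exists (b + c); rewrite ?addrK.
Qed.

Lemma represents_translate (G : finZmodType) (A : {set G}) (c : G) h g :
  represents (translate A c) h g <-> represents A h (g + c *+ h).
Proof.
have inj : {in A &, injective (fun b => b - c)} by move=> b d _ _ /addIr.
split=> [[x [xh xg]]|[x [xh xg]]].
  exists (fun b => x (b - c)); split; first by rewrite -xh big_imset.
  rewrite -xg big_imset //= -xh big_imset //= -sumrMnr -big_split /=.
  by apply: eq_bigr => b _; rewrite -mulrnDl subrK.
exists (fun b => x (b + c)); split.
  by rewrite big_imset //= -xh; apply: eq_bigr => b _; rewrite subrK.
rewrite big_imset //=.
transitivity (\sum_(b in A) (b *+ x b - c *+ x b)).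
  by apply: eq_bigr => b _; rewrite subrK mulrnBl.
by rewrite sumrB xg sumrMnr xh addrK.
Qed.

Lemma translate_full (G : finZmodType) (A : {set G}) (c : G) h :
  (forall g, represents (translate A c) h g) <-> (forall g, represents A h g).
Proof.
split=> full g; last by apply/represents_translate.
by rewrite -[g](subrK (c *+ h)); apply/represents_translate.
Qed.

(** * Extremal representations and a dominant summand *)

Definition geodesic (G : finZmodType) (A : {set G}) (h : nat) (g : G) : Prop :=
  represents A h g /\ forall i, (i < h)%N -> ~ represents A i g.

Definition extremal (G : finZmodType) (A : {set G}) (h : nat) (g : G)
    (x : G -> nat) : Prop :=
  [/\ (\sum_(b in A) x b = h)%N, \sum_(b in A) b *+ x b = g
    & forall y : G -> nat,
        (\sum_(b in A) y b = h)%N -> \sum_(b in A) b *+ y b = g ->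
        (\sum_(b in A) y b ^ 2 <= \sum_(b in A) x b ^ 2)%N].

Lemma extremal_exists (G : finZmodType) (A : {set G}) h g :
  represents A h g -> exists x, extremal A h g x.
Proof.
move=> [x0 [x0h x0g]].
pose P N := `[< exists x : G -> nat, [/\ (\sum_(b in A) x b = h)%N,
  \sum_(b in A) b *+ x b = g & (\sum_(b in A) x b ^ 2 = N)%N] >].
have exP : exists N, P N by exists (\sum_(b in A) x0 b ^ 2)%N; apply/asboolP; exists x0.
have ubP N : P N -> (N <= h * h)%N.
  move=> /asboolP[x [xh _ <-]]; rewrite -{1}xh big_distrl /=.
  apply: leq_sum => b bA; rewrite leq_mul2l -xh (bigD1 b) //= leq_addr.
  by rewrite orbT.
case: (ex_maxnP exP ubP) => N /asboolP[x [xh xg xN]] maxN.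
exists x; split=> // y yh yg; rewrite xN; apply: maxN.
by apply/asboolP; exists y.
Qed.

(** The excess over [2 * x ^ 2] is what makes a multiset with the largest sum of
    squares rigid under exchanges. *)
Lemma sqrn_swap (x y z : nat) : (y <= x)%N -> (z <= x)%N ->
  ((x - y + z) ^ 2 + (x - z + y) ^ 2
     = x ^ 2 + x ^ 2 + 2 * ((y - z) ^ 2 + (z - y) ^ 2))%N.
Proof.
wlog le : y z / (y <= z)%N.
  move=> W yx zx; case/orP: (leq_total y z) => le; first exact: W.
  by rewrite addnC [(_ ^ 2 + (z - y) ^ 2)%N]addnC W.
rewrite -(subnKC le); move: (z - y)%N => d _ le'.
rewrite -(subnKC le'); move: (x - _)%N => u.
have -> : (y + d + u - y + (y + d) = u + y + 2 * d)%N by lia.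
have -> : (y + d + u - (y + d) + y = u + y)%N by lia.
have -> : (y - (y + d) = 0)%N by lia.
have -> : (y + d - y = d)%N by lia.
ring.
Qed.

(** Exchanging y for z inside x, or z for y, gives two more representations of g;
    geodesicity makes them of length h, and by [sqrn_swap] one of them beats x
    unless y and z agree. *)
Lemma subrepresentation_inj (G : finZmodType) (A : {set G}) h g
    (x y z : G -> nat) :
  geodesic A h g -> extremal A h g x ->
  {in A, forall b, y b <= x b}%N -> {in A, forall b, z b <= x b}%N ->
  \sum_(b in A) b *+ y b = \sum_(b in A) b *+ z b ->
  {in A, y =1 z}.
Proof.
move=> [_ hmin] [xh xg xmax].
(* x - u + v represents g with h - |u| + |v| terms *)
have swap (u v : G -> nat) : {in A, forall b, u b <= x b}%N ->
    \sum_(b in A) b *+ u b = \sum_(b in A) b *+ v b ->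
    (\sum_(b in A) (x b - u b + v b) + \sum_(b in A) u b
       = h + \sum_(b in A) v b)%N /\
    \sum_(b in A) b *+ (x b - u b + v b)%N = g.
  move=> ux uv; split.
    rewrite -xh -!big_split; apply: eq_bigr => b /ux; rewrite /=; lia.
  transitivity (\sum_(b in A) (b *+ x b - b *+ u b + b *+ v b)).
    by apply: eq_bigr => b /ux ub; rewrite mulrnDr mulrnBr.
  by rewrite big_split sumrB /= xg uv subrK.
have size_le (u v : G -> nat) : {in A, forall b, u b <= x b}%N ->
    \sum_(b in A) b *+ u b = \sum_(b in A) b *+ v b ->
    (\sum_(b in A) u b <= \sum_(b in A) v b)%N.
  move=> ux uv; have [e1 e2] := swap u v ux uv; rewrite leqNgt; apply/negP => lt.
  apply: (hmin (\sum_(b in A) (x b - u b + v b))%N); last by eexists.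
  by rewrite -(ltn_add2r (\sum_(b in A) u b)) e1 ltn_add2l.
move=> yx zx yz.
have eqs : (\sum_(b in A) y b = \sum_(b in A) z b)%N.
  by apply/eqP; rewrite eqn_leq !size_le.
have [y1 y2] := swap y z yx yz; have [z1 z2] := swap z y zx (esym yz).
move: y1 z1; rewrite eqs => /addIn y1 /addIn z1.
have := leq_add (xmax _ y1 y2) (xmax _ z1 z2).
rewrite -!big_split /= => le b bA; apply/eqP/negPn/negP => neq.
move: le; apply/negP; rewrite -ltnNge.
rewrite (bigD1 b) //= [in ltnRHS](bigD1 b) //= -addSn leq_add //.
  rewrite (sqrn_swap (yx b bA) (zx b bA)) -addn1 leq_add2l muln_gt0 /= addn_gt0.
  by rewrite !expn_gt0 !orbF !subn_gt0 orbC -neq_ltn.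
apply: leq_sum => c /andP[cA _].
by rewrite (sqrn_swap (yx c cA) (zx c cA)) leq_addr.
Qed.

Lemma card_box (G : finZmodType) (A : {set G}) h g (x : G -> nat) :
  geodesic A h g -> extremal A h g x ->
  (\prod_(b in A) (x b).+1 <= #|G|)%N.
Proof.
move=> geo ext; have [xh xg _] := ext.
pose x' b := if b \in A then x b else 0%N.
have x'h b : (x' b <= h)%N.
  by rewrite /x'; case: ifP => // bA; rewrite -xh (bigD1 b) //= leq_addr.
pose F b := [pred j : 'I_h.+1 | (j <= x' b)%N].
have cardF b : #|F b| = (x' b).+1.
  rewrite -sum1_card -[RHS]card_ord -sum1_card.
  by rewrite (big_ord_widen h.+1 (fun=> 1%N)) //= ltnS.
have -> : (\prod_(b in A) (x b).+1 = #|family F|)%N.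
  rewrite card_family foldrE big_map big_enum /= big_mkcond /=.
  by apply: eq_bigr => b _; rewrite cardF /x'; case: ifP.
rewrite -(card_in_imset (f := fun f : {ffun G -> 'I_h.+1} => \sum_(b in A) b *+ f b)).
  exact: max_card.
move=> f1 f2 /familyP f1F /familyP f2F eqf; apply/ffunP => b; apply: val_inj => /=.
case: (boolP (b \in A)) => bA.
  apply: (subrepresentation_inj geo ext _ _ eqf bA) => c cA.
    by have := f1F c; rewrite inE /x' cA.
  by have := f2F c; rewrite inE /x' cA.
have := f1F b; have := f2F b; rewrite !inE /x' (negbTE bA) !leqn0.
by move=> /eqP -> /eqP ->.
Qed.

(** The terms of degree 0 and 1 in the expansion of the product. *)
Lemma sum_lt_prodS (I : finType) (P : pred I) (x : I -> nat) :
  (\sum_(i | P i) x i < \prod_(i | P i) (x i).+1)%N.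
Proof.
elim/big_rec2: _ => // i p s _ /=; nia.
Qed.

Lemma geodesic_lt_card (G : finZmodType) (A : {set G}) h g :
  geodesic A h g -> (h < #|G|)%N.
Proof.
move=> geo; have [x ext] := extremal_exists geo.1; have [xh _ _] := ext.
by apply: leq_trans (card_box geo ext); rewrite -{1}xh sum_lt_prodS.
Qed.

Lemma tri_leq_expn t : (t * t.+1 <= 2 * 2 ^ t)%N.
Proof.
elim: t => // -[//|[//|t]] IH; rewrite expnS.
by apply: (leq_trans _ (leq_mul (leqnn 2) (leq_trans IH _))); nia.
Qed.

(** Let a carry the largest multiplicity, and let t be the number and s the total
    multiplicity of the other elements that occur. The product Q over these is
    at least 2 ^ t and exceeds s, while s <= t * x a gives Q < k (t + 1). So
    2 ^ t < k (t + 1), whence t < 2 k, and then s < Q is bounded. *)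
Lemma dominant_coord (G : finZmodType) (A : {set G}) (x : G -> nat) k :
  (\prod_(b in A) (x b).+1 <= k * \sum_(b in A) x b)%N ->
  exists2 a, a \in A & (\sum_(b in A) x b <= x a + 2 * k ^ 2)%N.
Proof.
move=> le_prod.
have [a0 a0A] : exists a, a \in A.
  apply/set0Pn/eqP => A0; move: le_prod.
  by rewrite A0 !big_set0 muln0.
case: (arg_maxnP x a0A) => a aA amax; exists a => //.
move: le_prod; rewrite !(bigD1 a aA) /=.
set Q := (\prod_(_ | _) _)%N; set s := (\sum_(_ | _) _)%N => le_prod.
pose t := (\sum_(b in A | b != a) (0 < x b))%N.
have tQ : (2 ^ t <= Q)%N.
  rewrite /t /Q; elim/big_rec2: _ => // b p q _ le1; rewrite expnD.
  by apply: leq_mul => //; case: (x b).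
have sQ : (s < Q)%N by exact: sum_lt_prodS.
have st : (s <= t * x a)%N.
  rewrite /s /t big_distrl /=; apply: leq_sum => b /andP[bA _].
  by have := amax b bA; case: (x b) => //= m; rewrite mul1n.
have Qt : (Q < k * t.+1)%N by nia.
have := tri_leq_expn t => tri.
have t2k : (t < 2 * k)%N by nia.
rewrite leq_add2l; nia.
Qed.

(** The multiples of a up to X a are reached no faster than by adding a itself.
    This is all that is retained of the geodesic in the sequel. *)
Definition straight (G : finZmodType) (A : {set G}) (a : G) (X : nat) : Prop :=
  forall i j, (i < j <= X)%N -> ~ represents A i (a *+ j).

(** A shorter way to write j a, put in place of j of the copies of a inside the
    extremal representation, would shorten the geodesic. *)
Lemma geodesic_straight (G : finZmodType) (A : {set G}) k h g :
  geodesic A h g -> (#|G| <= k * h)%N ->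
  exists a X, [/\ a \in A, straight A a X & (h <= X + 2 * k ^ 2)%N].
Proof.
move=> geo le_n; have [x ext] := extremal_exists geo.1.
have [xh xg _] := ext.
have [|a aA hx] := @dominant_coord G A x k.
  by rewrite xh; apply: leq_trans le_n; apply: card_box geo ext.
exists a, (x a); split=> //; last by rewrite -{1}xh.
move=> i j /andP[ij jx] ri.
(* trade j copies of a for the i terms of a shorter representation *)
have r2 : represents A (h - j) (g - a *+ j).
  exists (fun b => x b - (b == a) * j)%N; split.
    rewrite -xh !(bigD1 a aA) /= eqxx mul1n -addnBAC //; congr (_ + _)%N.
    by apply: eq_bigr => b /andP[_ /negbTE ->]; rewrite mul0n subn0.
  rewrite -xg !(bigD1 a aA) /= eqxx mul1n mulrnBr // addrAC; congr (_ + _ + _).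
  by apply: eq_bigr => b /andP[_ /negbTE ->]; rewrite mul0n subn0.
have jh : (j <= h)%N by rewrite (leq_trans jx) // -xh (bigD1 a aA) leq_addr.
apply: (geo.2 (i + (h - j))%N); first by lia.
by rewrite -[g](subrKC (a *+ j)); apply: representsD.
Qed.

(** * Commensurability with the dominant summand *)

(** Translation by g permutes G, hence fixes the sum of all its elements. *)
Lemma mulrn_card (G : finZmodType) (g : G) : g *+ #|G| = 0.
Proof.
apply: (addIr (\sum_(x : G) x)); rewrite add0r -sumr_const -big_split /=.
by rewrite [RHS](reindex_inj (addrI g)).
Qed.

Lemma straight_eq0 (G : finZmodType) (A : {set G}) a X (r : int) :
  straight A a X -> (`|r| <= X)%N -> a *~ r = 0 -> r = 0.
Proof.
move=> str rX ar0; apply/eqP; rewrite -absz_eq0 -leqn0 leqNgt; apply/negP => r0.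
apply: (str 0%N `|r|%N); rewrite ?r0 //.
have -> : a *+ `|r|%N = 0.
  case: (intP r) ar0 => // m; rewrite ?NegzE ?mulrNz ?abszN //.
  by move/eqP; rewrite oppr_eq0 => /eqP.
by exists (fun=> 0%N); rewrite big1_eq big1.
Qed.

Lemma straight_inj (G : finZmodType) (A : {set G}) a X (r r' : int) :
  straight A a X -> (`|r - r'| <= X)%N -> a *~ r = a *~ r' -> r = r'.
Proof.
move=> str le /eqP; rewrite -subr_eq0 -mulrzBr => /eqP /(straight_eq0 str le) e.
by apply/eqP; rewrite -subr_eq0 e.
Qed.

(** Two of the elements j b + i a with j <= 6 k and i < X / 2 coincide, so that
    s b = r a with s <= 6 k and |r| < X / 2. If r >= 0, straightness gives r <= s.
    If r = - t < 0, then 0 = s b + t a, and adding this relation to X a until the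
    multiple of a has passed n a = 0 writes X a with about n s / t + t summands;
    straightness makes this at least X, which bounds t. *)
Lemma straight_relation (G : finZmodType) (A : {set G}) k a X b :
  (0 < k)%N -> a \in A -> b \in A -> straight A a X ->
  (#|G| <= 2 * k * X)%N -> (24 * k <= X)%N ->
  exists s (r : int),
    [/\ (0 < s <= 6 * k)%N, (`|r| <= 48 * k ^ 2)%N & b *+ s = a *~ r].
Proof.
move=> k0 aA bA str nX kX.
have XG : (X < #|G|)%N.
  rewrite ltnNge; apply/negP => GX.
  have := straight_eq0 (r := #|G|) str GX (mulrn_card a).
  by have : (0 < #|G|)%N by [apply/card_gt0P; exists 0]; lia.
pose f (p : 'I_(6 * k).+1 * 'I_(X./2)) := b *+ p.1 + a *+ p.2.
have /injectivePn[[j i] [[j' i']]] : ~~ injectiveb f.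
  apply/injectiveP => /leq_card; rewrite card_prod !card_ord => le.
  have Xh : (X <= 2 * X./2 + 1)%N by have := odd_double_half X; lia.
  have := leq_mul (leqnn (2 * k)) Xh; have h0 : (2 <= X./2)%N by lia.
  have : (k * 2 <= k * X./2)%N by rewrite leq_mul2l h0 orbT.
  have := leq_trans le nX.
  move: h0; move: X./2 => m; clear; nia.
wlog lt : j i j' i' / (j' < j)%N.
  move=> W neq eq; case: (ltngtP j' j) => lt.
  - exact: (W j i j' i').
  - by apply: (W j' i' j i); rewrite // eq_sym.
  - move: neq eq; rewrite /f /= lt => /eqP neq /addrI eq; case: neq.
    have le : (`|i%:Z - i'%:Z| <= X)%N by have := ltn_ord i; have := ltn_ord i'; lia.
    have [e] := straight_inj (r := i%:Z) (r' := i'%:Z) str le eq.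
    by congr pair; exact: val_inj.
move=> _; rewrite /f /= => eq.
have {eq} eq : b *+ (j - j') = a *~ (i'%:Z - i%:Z).
  rewrite mulrnBr 1?ltnW // mulrzBr; apply/eqP.
  by rewrite subr_eq addrAC eq_sym subr_eq addrC -eq addrC.
have jk : (j - j' <= 6 * k)%N by have := ltn_ord j; lia.
have j0 : (0 < j - j')%N by lia.
have iX := ltn_ord i; have i'X := ltn_ord i'.
exists (j - j')%N, (i'%:Z - i%:Z); split=> //; first by rewrite j0.
move: {lt} (j - j')%N jk j0 eq => s sk s0.
case: (leqP i i') => [le|lt].
  rewrite subzn // => eq.
  have : ~ (s < i' - i)%N.
    move=> lt; apply: (str s (i' - i)%N); first by lia.
    by rewrite -[a *+ _]eq; exact: represents_mulrn.
  by rewrite absz_nat; nia.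
rewrite -opprB (subzn (ltnW lt)) abszN absz_nat mulrNz => eq.
have {eq} eq : b *+ s + a *+ (i - i') = 0 by rewrite eq addNr.
have : (0 < i - i')%N by lia.
have : (2 * (i - i') <= X)%N by have := odd_double_half X; lia.
move: {i' i lt iX i'X} (i - i')%N eq => t eq tX t0.
(* a X = a n - a (n - X) rewritten by -a t = b s with few summands *)
pose q := ((#|G| - X) %/ t)%N.
have le1 : (q * t <= #|G|)%N by apply: (leq_trans (leq_divM _ _)); lia.
have lt2 : (#|G| - X < q.+1 * t)%N by rewrite ltn_ceil.
pose u := (X + q.+1 * t - #|G|)%N.
have ut : (u <= t)%N by have := leq_divM (#|G| - X) t; rewrite /u -/q; nia.
have : represents A (q.+1 * s + u) (a *+ X).
  have -> : a *+ X = b *+ (q.+1 * s) + a *+ u.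
    have -> : a *+ X = a *+ X + (b *+ s + a *+ t) *+ q.+1 by rewrite eq mul0rn addr0.
    rewrite mulrnDl -!mulrnA addrCA -mulrnDr [(t * _)%N]mulnC [(s * _)%N]mulnC.
    congr (_ + _); rewrite -[RHS]add0r -(mulrn_card a) -mulrnDr /u; congr (_ *+ _).
    by lia.
  by apply: representsD; exact: represents_mulrn.
move=> long; have {long} le3 : (X <= q.+1 * s + u)%N.
  by rewrite leqNgt; apply/negP => lt; apply: str long; rewrite lt leqnn.
have le4 : (X <= 24 * k * q)%N.
  have : (q.+1 * s <= q.+1 * (6 * k))%N by rewrite leq_mul2l sk.
  by lia.
have le5 : (X * t <= 24 * k * (2 * k * X))%N.
  apply: leq_trans (leq_mul le4 (leqnn t)) _; rewrite -mulnA leq_mul2l.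
  by rewrite (leq_trans le1) ?orbT.
rewrite -(leq_pmul2l (_ : 0 < X)%N); last by lia.
by apply: leq_trans le5 _; rewrite mulnA [leqRHS]mulnC; apply/eq_leq; lia.
Qed.

(** All the factors s of [straight_relation] divide (6 k)!. *)
Lemma commensurable (G : finZmodType) (A : {set G}) k a X :
  (0 < k)%N -> a \in A -> straight A a X ->
  (#|G| <= 2 * k * X)%N -> (24 * k <= X)%N ->
  let S := ((6 * k)`!)%N in
  exists R : G -> int, {in A, forall b,
    b *+ S = a *~ R b /\ (`|R b| <= 48 * k ^ 2 * S)%N}.
Proof.
move=> k0 aA str nX kX S.
suff /choice[R RP] : forall b, exists r : int, b \in A ->
    b *+ S = a *~ r /\ (`|r| <= 48 * k ^ 2 * S)%N by exists R.
move=> b; have [bA|//] := boolP (b \in A); last by exists 0.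
have [s [r [sk rk eq]]] := straight_relation k0 aA bA str nX kX.
have /dvdnP[m Sm] : (s %| S)%N by apply: dvdn_fact.
exists (r * m%:Z) => _; split; first by rewrite Sm mulnC mulrnA eq mulrzA.
have /andP[s0 _] := sk.
rewrite abszM absz_nat leq_mul // Sm; exact: leq_pmulr.
Qed.

(** The elements b + (L i) a with 0 <= i < I are distinct for L = 2 C + 1: after
    multiplication by S a coincidence reads R b - R b' = S L (i' - i), where the
    left side is smaller than L in absolute value. Since I is of the order of X,
    hence of n, few b fit into G. *)
Lemma card_commensurable (G : finZmodType) (A : {set G}) k a X S C (R : G -> int) :
  straight A a X -> (0 < S)%N ->
  {in A, forall b, b *+ S = a *~ R b /\ (`|R b| <= C)%N} ->
  (#|G| <= 2 * k * X)%N -> (4 * S * (2 * C).+1 <= X)%N ->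
  (#|A| <= 8 * k * S * (2 * C).+1)%N.
Proof.
move=> str S0 RP nX; set L := (2 * C).+1 => SX.
pose I := (X %/ (2 * S * L))%N.
have SL0 : (0 < S * L)%N by rewrite muln_gt0 S0.
have XI1 : (I * (2 * S * L) <= X)%N by rewrite leq_divM.
have XI2 : (X < I.+1 * (2 * S * L))%N by rewrite ltn_ceil // -mulnA muln_gt0.
have I0 : (0 < I)%N by nia.
have XI3 : (X <= I * (4 * S * L))%N by nia.
suff : (#|A| * I <= #|G|)%N.
  move=> le; have := leq_trans le nX => {}le.
  rewrite -(leq_pmul2r I0); apply: (leq_trans le).
  apply: (leq_trans (leq_mul (leqnn _) XI3)); apply/eq_leq; lia.
rewrite -[I]card_ord -[#|'I_I|]cardsT -cardsX.
rewrite -(card_in_imset (f := fun p : G * 'I_I => p.1 + a *+ (L * p.2))).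
  exact: max_card.
move=> [b i] [b' i']; rewrite !inE !andbT /= => bA b'A eq.
have [Rb bC] := RP b bA; have [Rb' b'C] := RP b' b'A.
have e1 : a *~ (R b + (S * L * i)%N%:Z) = a *~ (R b' + (S * L * i')%N%:Z).
  have := congr1 (fun g => g *+ S) eq.
  rewrite !mulrnDl Rb Rb' -!mulrnA !mulrzDr.
  by rewrite ![(_ * S)%N]mulnC !mulnA.
have iI := ltn_ord i; have i'I := ltn_ord i'.
have e2 := straight_inj str _ e1.
have {e2} e2 : R b + (S * L * i)%N%:Z = R b' + (S * L * i')%N%:Z.
  apply: e2.
  have : (S * L * i <= S * L * I)%N by rewrite leq_mul2l ltnW ?orbT.
  have : (S * L * i' <= S * L * I)%N by rewrite leq_mul2l ltnW ?orbT.
  move: bC b'C XI1 SX S0; rewrite /L; nia.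
have ii' : i = i'.
  by apply: val_inj; move: e2 bC b'C; rewrite /L /=; nia.
by move: eq; rewrite ii' => /addIr ->.
Qed.

(** * Heights *)

Definition has_height (G : finZmodType) (A : {set G}) (R : G -> nat)
    (g : G) (i : int) : Prop :=
  exists x : G -> int,
    \sum_(b in A) b *~ x b = g /\ \sum_(b in A) x b * (R b)%:Z = i.

Lemma heightD (G : finZmodType) (A : {set G}) R g g' i i' :
  has_height A R g i -> has_height A R g' i' ->
  has_height A R (g + g') (i + i').
Proof.
move=> [x [<- <-]] [y [<- <-]]; exists (fun b => x b + y b); split.
  by rewrite -big_split; apply: eq_bigr => b _; rewrite mulrzDr.
by rewrite -big_split; apply: eq_bigr => b _; rewrite mulrDl.
Qed.

Lemma heightM (G : finZmodType) (A : {set G}) R g i (m : int) :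
  has_height A R g i -> has_height A R (g *~ m) (i * m).
Proof.
move=> [x [<- <-]]; exists (fun b => x b * m); split.
  by rewrite mulrz_suml; apply: eq_bigr => b _; rewrite mulrzA.
by rewrite big_distrl; apply: eq_bigr => b _; rewrite mulrAC.
Qed.

Lemma represents_height (G : finZmodType) (A : {set G}) R D h g :
  {in A, forall b, R b <= D}%N -> represents A h g ->
  exists2 i : nat, (i <= h * D)%N & has_height A R g i.
Proof.
move=> RD [x [<- <-]]; exists (\sum_(b in A) x b * R b)%N.
  by rewrite big_distrl; apply: leq_sum => b /RD le; rewrite leq_mul2l le orbT.
exists (fun b => x b); split=> //.
by rewrite (big_morph Posz PoszD (erefl _)).
Qed.

Lemma height_mem (G : finZmodType) (A : {set G}) R b :
  b \in A -> has_height A R b (R b).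
Proof.
move=> bA; exists (fun c => (c == b)%:Z); split.
  rewrite (bigD1 b) //= eqxx mulr1z big1 ?addr0 // => c /andP[_ /negbTE ->].
  by rewrite mulr0z.
rewrite (bigD1 b) //= eqxx mul1r big1 ?addr0 // => c /andP[_ /negbTE ->].
by rewrite mul0r.
Qed.

(** Since S b = (R b) a for b in A, one has (S R t) b = (S R b) t, an identity that
    preserves heights. It reduces all coefficients modulo S R t and leaves a
    nonnegative combination u of at most C terms plus a multiple p t. The bounds
    on the height i of g say that p >= 0 and that p + C <= h. *)
Lemma height_represents (G : finZmodType) (A : {set G}) (R : G -> nat) a t S h g
    (i : int) :
  0 \in A -> t \in A -> (0 < S)%N -> (0 < R t)%N ->
  {in A, forall b, R b <= R t}%N ->
  {in A, forall b, b *+ S = a *+ R b} ->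
  let C := (#|A| * (S * R t))%N in
  (C * R t)%N%:Z <= i -> i + (C * R t)%N%:Z <= (h * R t)%N%:Z ->
  has_height A R g i -> represents A h g.
Proof.
move=> A0 tA S0; move eD : (R t) => D D0 RD SR C iC Ci [x [xg xi]].
pose Q := (S * D)%N.
have Q0 : (Q%:Z != 0) by rewrite eqz_nat -lt0n muln_gt0 S0.
pose u b := `|(x b %% Q)%Z|%N.
have uE b : (u b)%:Z = (x b %% Q)%Z by rewrite gez0_abs ?modz_ge0.
have uQ b : (u b <= Q)%N by rewrite -lez_nat uE ltW // ltz_pmod // ltz_nat muln_gt0 S0.
have xE b : x b = (x b %/ Q)%Z * Q%:Z + (u b)%:Z by rewrite uE -divz_eq.
pose U := (\sum_(b in A) u b)%N.
have UC : (U <= C)%N by rewrite /C -sum_nat_const; apply: leq_sum => b _; exact: uQ.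
pose p := \sum_(b in A) (x b %/ Q)%Z * (S * R b)%N%:Z.
pose m := (\sum_(b in A) u b * R b)%N.
have mU : (m <= U * D)%N.
  by rewrite big_distrl; apply: leq_sum => b /RD le; rewrite leq_mul2l le orbT.
have iE : i = p * D%:Z + m%:Z.
  rewrite -xi (big_morph Posz PoszD (erefl _)) big_distrl -big_split /=.
  by apply: eq_bigr => b _; rewrite {1}xE !PoszM; ring.
have gE : g = t *~ p + \sum_(b in A) b *+ u b.
  rewrite -xg mulrz_sumr -big_split; apply: eq_bigr => b bA.
  rewrite {1}xE mulrzDr; congr (_ + _).
  rewrite ![(x b %/ Q)%Z * _]mulrC !mulrzA; congr (_ *~ _).
  rewrite -!pmulrn !mulrnA (SR b bA) (SR t tA) eD -!mulrnA.
  by rewrite mulnC.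
have p0 : 0 <= p.
  have : (m <= C * D)%N by apply: leq_trans mU _; rewrite leq_mul2r UC orbT.
  by move: iC; rewrite iE; nia.
have ph : p + C%:Z <= h%:Z.
  by move: Ci; rewrite iE !PoszM; nia.
rewrite gE; case: p p0 ph {iE gE} => // p _ ph.
apply: (represents_leq (h := (p + U)%N) A0); first by lia.
by apply: representsD; [exact: represents_mulrn | exists u].
Qed.

(** Here q is the least positive height of 0. It divides every other height of 0,
    in particular the height n (R t) of n t = 0. If all of G is represented with
    h summands, comparing (h + 1) t with its representation gives 0 a height
    between 1 and (h + 1) (R t). Conversely, each element has a height in every
    window of q consecutive integers, so it suffices that the window allowed by
    [height_represents] has this length. *)
Lemma period_exists (G : finZmodType) (A : {set G}) (R : G -> nat) a t S h0 :
  0 \in A -> t \in A -> (0 < S)%N -> (0 < R t)%N ->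
  {in A, forall b, R b <= R t}%N ->
  {in A, forall b, b *+ S = a *+ R b} ->
  (forall g, represents A h0 g) ->
  exists q : nat,
    [/\ (0 < q)%N, (q %| #|G| * R t)%N,
        forall h, (forall g, represents A h g) -> (q <= h.+1 * R t)%N
      & forall h, (q <= (h - 2 * (#|A| * (S * R t))) * R t)%N ->
          forall g, represents A h g].
Proof.
move=> A0 tA S0 D0 RD SR full0.
pose P m := (0 < m)%N && `[< has_height A R 0 m%:Z >].
have Pmul : has_height A R 0 (#|G| * R t)%N.
  have := heightM #|G|%:Z (height_mem R tA).
  by rewrite -pmulrn mulrn_card -PoszM mulnC.
have exP : exists m, P m.
  exists (#|G| * R t)%N; apply/andP; split; last exact/asboolP.
  by rewrite muln_gt0 D0 andbT; apply/card_gt0P; exists 0.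
case: (ex_minnP exP) => q /andP[q0 /asboolP hq] qmin; exists q; split=> //.
- rewrite /dvdn; set n := (#|G| * _)%N in Pmul *.
  rewrite -leqn0 leqNgt; apply/negP => r0.
  have : P (n %% q)%N.
    rewrite /P r0; apply/asboolP.
    have := heightD Pmul (heightM (- (n %/ q)%N%:Z) hq).
    rewrite mul0rz addr0; suff -> : n%:Z + q%:Z * - (n %/ q)%N%:Z = (n %% q)%N by [].
    by have := divn_eq n q; move: (n %/ q)%N (n %% q)%N => d r ->; lia.
  by move/qmin; rewrite leqNgt ltn_pmod.
- move=> h full.
  have [i ih hi] := represents_height RD (full (t *+ h.+1)).
  have iD : (i < h.+1 * R t)%N by rewrite mulSn; lia.
  apply: (@leq_trans (h.+1 * R t - i)); last exact: leq_subr.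
  apply: qmin; rewrite /P subn_gt0 iD; apply/asboolP.
  have := heightD (heightM h.+1%:Z (height_mem R tA)) (heightM (-1) hi).
  rewrite -pmulrn mulrN1z subrr mulrN1 -PoszM mulnC => H.
  by rewrite -(subzn (ltnW iD)).
- move=> h; set C := (#|A| * _)%N => qh g.
  have [i _ hi] := represents_height RD (full0 g).
  pose j := ((i%:Z - (C * R t)%N%:Z) %/ q)%Z.
  have := heightD hi (heightM (- j) hq).
  rewrite mul0rz addr0.
  have e : i%:Z + q%:Z * - j = (C * R t)%N%:Z + ((i%:Z - (C * R t)%N%:Z) %% q)%Z.
    by have := divz_eq (i%:Z - (C * R t)%N%:Z) q; rewrite -/j; move: (_ %% _)%Z => r; lia.
  rewrite e; apply: (height_represents A0 tA S0 D0 RD SR).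
    by rewrite lerDl modz_ge0 // eqz_nat -lt0n.
  have : ((i%:Z - (C * R t)%N%:Z) %% q)%Z < q by rewrite ltz_pmod // ltz_nat.
  rewrite -/C; move: (_ %% _)%Z => r.
  have hC : (2 * C <= h)%N by lia.
  have : ((h - 2 * C) * R t + 2 * (C * R t) = h * R t)%N.
    by rewrite mulnA -mulnDl subnK.
  lia.
Qed.

(** * The order up to a constant *)

Lemma geodesic_exists (G : finZmodType) (A : {set G}) h :
  0 \in A -> (forall g, represents A h.+1 g) -> ~ (forall g, represents A h g) ->
  exists g, geodesic A h.+1 g.
Proof.
move=> A0 full /existsNP[g ng]; exists g; split=> // i ih ri.
by apply: ng; apply: represents_leq A0 _ ri.
Qed.

(** Translating by an element b0 of least height subtracts R b0 from all heights.
    They do not all agree, because R 0 = 0, while R a = 0 would make S a vanish. *)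
Lemma nonneg_heights (G : finZmodType) (A : {set G}) a X S C (R : G -> int) :
  0 \in A -> a \in A -> straight A a X -> (0 < S)%N ->
  {in A, forall b, b *+ S = a *~ R b /\ (`|R b| <= C)%N} ->
  (S + C <= X)%N ->
  exists b0, b0 \in A /\
  exists t (R' : G -> nat), [/\ t \in translate A b0, (0 < R' t <= 2 * C)%N,
    {in translate A b0, forall b, R' b <= R' t}%N
    & {in translate A b0, forall b, b *+ S = a *+ R' b}].
Proof.
move=> A0 aA str S0 RP SX.
have R0 : R 0 = 0.
  have [e le] := RP 0 A0; apply: (straight_eq0 str); first by lia.
  by rewrite -e mul0rn.
have Ra : R a <> 0.
  have [e _] := RP a aA => Ra; rewrite Ra mulr0z in e.
  by have := straight_eq0 (r := S) str; rewrite absz_nat => /(_ _ e) => H; have := H _; lia.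
case: (Order.TotalTheory.arg_minP R A0) => b0 b0A Rmin.
case: (Order.TotalTheory.arg_maxP R A0) => b1 b1A Rmax.
exists b0; split=> //; exists (b1 - b0), (fun b => absz (R (b + b0) - R b0)%R).
have R'E b : b + b0 \in A -> (absz (R (b + b0) - R b0)%R)%:Z = R (b + b0) - R b0.
  by move=> bA; rewrite gez0_abs // subr_ge0; apply: Rmin.
split.
- by rewrite translateE subrK.
- rewrite subrK; have := Rmin a aA; have := Rmax a aA.
  have := Rmin 0 A0; have := Rmax 0 A0; rewrite R0.
  by have [_] := RP _ b0A; have [_] := RP _ b1A; lia.
- move=> b; rewrite translateE => bA; rewrite -lez_nat subrK.
  have := Rmax _ bA; have := Rmin _ bA; lia.
- move=> b; rewrite translateE => bA; rewrite [RHS]pmulrn R'E // mulrzBr.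
  have [<- _] := RP _ bA; have [<- _] := RP _ b0A.
  by rewrite -mulrnBl addrK.
Qed.

(** The theorem in natural numbers: the two final inequalities say that h is
    within c of n / l. *)
Lemma order_near_quotient k : (0 < k)%N ->
  exists c : nat, forall (G : finZmodType) (A : {set G}) h,
    (0 < h)%N -> (forall g, represents A h g) ->
    (forall h', (0 < h' < h)%N -> ~ (forall g, represents A h' g)) ->
    (#|G| <= k * h)%N ->
    exists l, [/\ (0 < l <= k)%N, (#|G| <= l * (h + c))%N
                & (l * h <= #|G| + l * c)%N].
Proof.
move=> k0.
pose S := ((6 * k)`!)%N; pose C := (48 * k ^ 2 * S)%N.
pose K := (8 * k * S * (2 * C).+1)%N.
pose B := (1 + 2 * (K * (S * (2 * C))))%N.
pose M := (24 * k + 4 * S * (2 * C).+1)%N.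
pose N := (4 * k ^ 3 + 2 * k * M + k * k.+1 * B + k)%N.
(* N bounds the n for which l = 1 works because 0 < h <= n; beyond N, the
   segment X is long enough for every step, and l <= k is forced. *)
exists (N + B)%N => G A h h0 full min_h nkh.
have n0 : (0 < #|G|)%N by apply/card_gt0P; exists 0.
case: h h0 full min_h nkh => // h _ full min_h nkh.
have [h0|h0] := posnP h.
  by exists 1%N; rewrite h0 muln1 in nkh *; split; rewrite /N; lia.
have [a0 a0A] : exists a, a \in A.
  have [x [xh _]] := full 0; apply/set0Pn/eqP => A0.
  by move: xh; rewrite A0 big_set0.
pose A1 := translate A a0.
have A10 : 0 \in A1 by rewrite translateE add0r.
have full1 : forall g, represents A1 h.+1 g by apply/translate_full.
have [g geo] : exists g, geodesic A1 h.+1 g.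
  apply: geodesic_exists => // /translate_full; apply: min_h.
  by rewrite h0 ltnS leqnn.
have hn := geodesic_lt_card geo.
have [nN|Nn] := leqP #|G| N.
  by exists 1%N; split; lia.
have [a [X [aA str hX]]] := geodesic_straight geo nkh.
have nX : (#|G| <= 2 * k * X)%N.
  have : (k * h.+1 <= k * X + 2 * k ^ 3)%N.
    by apply: leq_trans (leq_mul (leqnn k) hX) _; rewrite mulnDr expnS; lia.
  by move: Nn; rewrite /N; lia.
have MX : (M <= X)%N.
  rewrite -(leq_pmul2l (_ : 0 < 2 * k)%N) ?muln_gt0 //.
  by apply: leq_trans nX; rewrite /N in Nn; lia.
have S0 : (0 < S)%N by exact: fact_gt0.
have [|R RP] := commensurable k0 aA str nX; first by rewrite /M in MX; lia.
rewrite -/S -/C in RP; clearbody S C.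
have cardA1 : (#|A1| <= K)%N.
  by apply: (card_commensurable str S0 RP nX); rewrite /M in MX; lia.
have [|b0 [b0A [t [R' [tA /andP[D0 DC] RD SR]]]]] :=
    nonneg_heights A10 aA str S0 RP (X := X).
  by rewrite /M in MX; have := leq_pmull C S0; lia.
pose A2 := translate A1 b0.
have A20 : 0 \in A2 by rewrite translateE add0r.
have full2 i : (forall g, represents A2 i g) <-> (forall g, represents A i g).
  by rewrite /A2 translate_full /A1 translate_full.
have [q [q0 qn lower upper]] :=
  period_exists A20 tA S0 D0 RD SR (proj2 (full2 _) full).
have cardA2 : (#|A2| <= K)%N by apply: leq_trans cardA1; exact: leq_imset_card.
move: {RD SR} (R' t) D0 DC qn lower upper => D D0 DC /dvdnP[l nl] lower upper.
have {lower} lower : (q <= h.+2 * D)%N by apply: lower; apply/full2.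
have {upper} upper : (h.+1 * D < q + B * D)%N.
  have : ~ (q <= (h - 2 * (#|A2| * (S * D))) * D)%N.
    move=> /upper/full2; apply: min_h; lia.
  have : (#|A2| * (S * D) <= K * (S * (2 * C)))%N by rewrite !leq_mul.
  rewrite /B; move: (#|A2| * _)%N (K * _)%N => y z yz.
  move=> /negP; rewrite -ltnNge => lt.
  have yzD : (y * D <= z * D)%N by rewrite leq_mul2r yz orbT.
  have [le|lt'] := leqP (2 * y) h.
    have e : ((h - 2 * y) * D + 2 * y * D = h * D)%N by rewrite -mulnDl subnK.
    by move: lt e; move: (_ - _)%N => w; lia.
  have : (h.+1 * D <= 2 * y * D)%N by rewrite leq_mul2r lt' orbT.
  by clear -yzD q0; lia.
have l0 : (0 < l)%N by case: l nl => // nl; nia.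
have up : (l * h.+1 < #|G| + l * B)%N.
  rewrite -(ltn_pmul2r D0) mulnDl nl -mulnA -[in ltnRHS]mulnA -mulnDr.
  by rewrite ltn_pmul2l.
have low : (#|G| <= l * h.+2)%N.
  by rewrite -(leq_pmul2r D0) nl -mulnA leq_pmul2l.
exists l; split; last by lia.
(* otherwise l n <= k l h < k n + k l B, but l <= (k + 1) (l - k) *)
- rewrite l0 leqNgt; apply/negP => kl.
  have lt1 : (l * #|G| < k * #|G| + k * (l * B))%N.
    rewrite -mulnDr; apply: (@leq_ltn_trans (k * (l * h.+1))).
      by rewrite mulnCA leq_pmul2l.
    by rewrite ltn_pmul2l.
  have : (k * k.+1 * B < #|G|)%N by rewrite /N in Nn; lia.
  move: lt1; rewrite -(subnK (ltnW kl)).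
  have : (0 < l - k)%N by rewrite subn_gt0.
  move: (l - k)%N => d d0 lt1 lt2.
  have lt3 : (d * #|G| < k * (d + k) * B)%N by lia.
  have : (k * (d + k) * B <= d * (k * k.+1 * B))%N.
    rewrite [leqRHS]mulnA leq_mul2r; apply/orP; right.
    by have := leq_pmull (k * k) d0; clear; lia.
  by move=> le; have := leq_trans lt3 le; rewrite ltn_pmul2l //; lia.
- by apply: (leq_trans low); rewrite leq_mul2l; lia.
Qed.

Lemma sumset_full (G : finZmodType) (A : {set G}) h :
  sumset h A == [set: G] <-> (forall g, represents A h g).
Proof.
split=> [/eqP full g|full]; first by apply/sumsetP; rewrite full inE.
by apply/eqP/setP => g; rewrite inE; apply/sumsetP.
Qed.

Theorem mainTheorem1 (R : realType) (k : nat) (k_gt0 : (0 < k)%N) :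
  exists c : R, 0 < c /\
    forall (n : nat) (A : {set Zmod n}), (0 < n)%N ->
      is_basis A ->
      ((n%:R / k%:R)%:E <= rho R A)%E ->
      exists l : nat, (1 <= l <= k)%N /\
        (`| rho R A - (n%:R / l%:R)%:E | < c%:E)%E.
Proof.
have [c near] := order_near_quotient k_gt0.
exists (c%:R + 1); split=> [|n A n_gt0 basisA]; first by rewrite ltr_wpDl.
rewrite /rho; case: pselect => // {}basisA.
case: ex_minnP => h /andP[h_gt0 /sumset_full full] min_h.
rewrite lee_fin ler_pdivrMr ?ltr0n // -natrM ler_nat mulnC => n_le.
have cardG : #|Zmod n| = n by rewrite card_ord prednK.
case: (near _ A h h_gt0 full) => [h' /andP[h'_gt0 h'_lt] full'||l [l_bound lo up]].
- have /min_h : (0 < h')%N && (sumset h' A == [set: Zmod n]).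
    by rewrite h'_gt0; apply/sumset_full.
  by rewrite leqNgt h'_lt.
- by rewrite cardG.
rewrite cardG in lo up.
exists l; split=> //.
have l_gt0 : 0 < l%:R :> R by rewrite ltr0n; case/andP: l_bound.
rewrite -EFinB abse_EFin lte_fin.
apply: (@le_lt_trans _ _ c%:R); last by rewrite ltrDl.
rewrite ler_distl lerBlDr; apply/andP; split.
  by rewrite ler_pdivrMr // -natrD -natrM ler_nat mulnC.
by rewrite -lerBlDr ler_pdivlMr // mulrBl lerBlDr -!natrM -natrD ler_nat ![(_ * l)%N]mulnC.
Qed.
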